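(* For all positive integers $n$, $$ \sum_{d\mid n}\frac{1+2\,(-1)^{d}}{d}=\sum_{r=1}^{n}\frac{(-1)^{r}}{r}\,\binom{n}{r}\,t_{r}(n), $$ where $\sum_{d\mid n}$ denotes the sum over the positive divisors $d$ of $n$, and $t_r(n)$ denotes the number of representations of $n$ as an ordered sum of $r$ triangular numbers.
   Context: The triangular numbers are the numbers $m(m+1)/2$ with $m\ge 0$ an integer, i.e. $0,1,3,6,10,\dots$ (so $0$ is included). For a positive integer $r$ and an integer $n\ge 0$, $t_r(n)$ is the number of representations of $n$ as a sum of $r$ triangular numbers, where representations with different orders are counted as different; that is, $t_r(n)$ is the number of $r$-tuples $(T_1,\dots,T_r)$ of triangular numbers with $T_1+\cdots+T_r=n$. In particular $t_r(0)=1$. Equivalently, with $\Psi(q)=\sum_{m=0}^{\infty}q^{m(m+1)/2}$ for $|q|<1$, one has $\Psi(q)^r=\sum_{n=0}^{\infty}t_r(n)q^n$. *)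

(* Defs.v *)
(* MathComp *)
From mathcomp Require Import all_boot all_order all_algebra.

Set Implicit Arguments.
Unset Strict Implicit.
Unset Printing Implicit Defensive.

Definition triangular_number (m : nat) : nat := (m * m.+1)./2.

(* The index m may be bounded by T, because m <= m (m + 1) / 2; triangularP
   gives the unbounded characterization. *)
Definition triangular (T : nat) : bool :=
  [exists m : 'I_T.+1, T == triangular_number m].

Lemma leq_triangular_number m : m <= triangular_number m.
Proof.
rewrite /triangular_number; case: m => // m.
by rewrite -[X in X <= _]doubleK half_leq // -muln2 leq_pmul2l.
Qed.

Lemma triangularP T :
  reflect (exists m, T = triangular_number m) (triangular T).
Proof.
apply: (iffP existsP) => [[m /eqP ->] | [m defT]]; first by exists m.
have ltmT : m < T.+1 by rewrite ltnS defT leq_triangular_number.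
by exists (Ordinal ltmT); rewrite [X in X == _]defT.
Qed.

(* t r n counts the r-tuples of triangular numbers with sum n; the entries of
   such a tuple are all at most n, so they are taken in 'I_n.+1. *)
Definition t (r n : nat) : nat :=
  #|[set T : r.-tuple 'I_n.+1 |
      [forall i, triangular (tnth T i)] && (\sum_(i < r) tnth T i == n)]|.

(* Main.v *)
(* With Psi the generating function of the triangular numbers, expanding
   log Psi = - sum_j (1 - Psi)^j / j binomially and summing 'C(j, r) / j over
   j <= n shows that the right-hand side is - [q^n] log Psi.  Gauss's identity
   Psi = prod_k (1 - q^(2k)) / (1 - q^(2k-1)) gives
   n [q^n] log Psi = - sum_(d | n) (-1)^d d, which is elementarily - n times the
   left-hand side.  Everything is done with polynomials modulo 'X^n.+1, and
   Gauss's identity comes from the finite identity of Shanks, whose proof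
   telescopes. *)
Require Import Defs.
From mathcomp Require Import all_boot all_order all_algebra.
From mathcomp Require Import ring zify.

Set Implicit Arguments.
Unset Strict Implicit.
Unset Printing Implicit Defensive.

Import GRing.Theory Num.Theory.
Local Open Scope ring_scope.

(** * Finite form of Gauss's identity *)

(** With E_m and O_m the products over 1 <= k <= m of 1 - x^(2k) and of 1 - x^(2k-1), this is E_n
    O_s / E_s, kept free of division so that it makes sense in any commutative ring. *)
Definition shanks_weight (R : comNzRingType) (x : R) (n s : nat) : R :=
  (\prod_(s <= k < n) (1 - x ^+ k.+1.*2)) * \prod_(k < s) (1 - x ^+ k.*2.+1).

#[local] Arguments triangular_number : simpl never.

Lemma triangular_number_double n : triangular_number n.*2 = (n * n.*2.+1)%N.
Proof. by rewrite /triangular_number -doubleMl doubleK. Qed.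

Lemma triangular_number_doubleS n :
  triangular_number n.*2.+1 = (n.+1 * n.*2.+1)%N.
Proof. by rewrite /triangular_number -doubleS -doubleMr doubleK mulnC. Qed.

Lemma shanks_weight_recl (R : comNzRingType) (x : R) n s : (s < n)%N ->
  shanks_weight x n s * (1 - x ^+ s.*2.+1)
  = shanks_weight x n s.+1 * (1 - x ^+ s.+1.*2).
Proof.
move=> s_lt_n; rewrite /shanks_weight big_ltn // big_ord_recr /=; ring.
Qed.

Lemma shanks_weight_recr (R : comNzRingType) (x : R) n s : (s <= n)%N ->
  shanks_weight x n.+1 s = (1 - x ^+ n.+1.*2) * shanks_weight x n s.
Proof.
by move=> s_le_n; rewrite /shanks_weight big_nat_recr //= mulrAC mulrC mulrA.
Qed.

(* The term s = 0 is the product of the 1 - x ^+ k.+1.*2 and the other terms are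
   divisible by x ^+ n.*2.+1, so the limit n -> oo is Gauss's identity. *)
Lemma shanks_identity (R : comNzRingType) (x : R) n :
  (\prod_(k < n) (1 - x ^+ k.*2.+1)) * \sum_(m < n.*2) x ^+ triangular_number m
  = \sum_(s < n) shanks_weight x n s * x ^+ (s * n.*2.+1).
Proof.
elim: n => [|n IHn]; first by rewrite !big_ord0 mulr0.
(* Telescoping certificate for the passage from n to n+1; the factor [1 - x ^+ s.*2] makes [u 0]
   vanish. *)
pose u s := shanks_weight x n s * x ^+ (s * n.*2.+1) * (1 - x ^+ s.*2).
have telescope s : (s < n)%N ->
  shanks_weight x n.+1 s * x ^+ (s * n.+1.*2.+1)
  - (1 - x ^+ n.*2.+1) * (shanks_weight x n s * x ^+ (s * n.*2.+1))
  = u s.+1 - u s.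
  move=> s_lt_n; rewrite shanks_weight_recr 1?ltnW // /u.
  have -> : (s * n.+1.*2.+1 = s * n.*2.+1 + s.*2)%N by lia.
  (* Lowering the index s+1 to s makes every term a multiple of [shanks_weight x n s]. *)
  rewrite (mulrAC (shanks_weight x n s.+1)) -shanks_weight_recl //.
  rewrite mulSn !exprD doubleS !exprS; ring.
have sum_u : \sum_(s < n) (u s.+1 - u s) = u n.
  rewrite -(big_mkord xpredT (fun s => u s.+1 - u s)) telescope_sumr //.
  by rewrite /u double0 expr0 subrr mulr0 subr0.
rewrite doubleS !big_ord_recr /= -addrA mulrDr mulrAC IHn.
rewrite -doubleS triangular_number_double triangular_number_doubleS.
have -> : \sum_(s < n) shanks_weight x n.+1 s * x ^+ (s * n.+1.*2.+1)
  = u n + (1 - x ^+ n.*2.+1) *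
    \sum_(s < n) shanks_weight x n s * x ^+ (s * n.*2.+1).
  rewrite -sum_u mulr_sumr -big_split /=; apply: eq_bigr => s _.
  by rewrite -telescope // subrK.
rewrite shanks_weight_recr // /u /shanks_weight big_geq // mul1r.
have -> : (n * n.+1.*2.+1 = n * n.*2.+1 + n.*2)%N by lia.
rewrite doubleS mulSn !exprD !exprS; ring.
Qed.

(** * A binomial sum *)

(** Absorption turns each term into ['C(j, r.-1) / r], and the hockey-stick identity sums these. *)
Lemma sum_bin_div (n r : nat) : (0 < r)%N ->
  \sum_(j < n) 'C(j.+1, r)%:R / j.+1%:R = 'C(n, r)%:R / r%:R :> rat.
Proof.
case: r => // r _; elim: n => [|n IHn]; first by rewrite big_ord0 bin0n mul0r.
rewrite big_ord_recr /= IHn.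
have nz k : k.+1%:R != 0 :> rat by rewrite pnatr_eq0.
have step : 'C(n.+1, r.+1)%:R / n.+1%:R = 'C(n, r)%:R / r.+1%:R :> rat.
  apply/eqP; rewrite eqr_div //; apply/eqP.
  by rewrite -!natrM [in RHS]mulnC mul_bin_diag mulnC.
by rewrite step binS natrD mulrDl.
Qed.

(** * Logarithmic derivatives modulo a power of X *)

(** The Euler operator: unlike the plain derivative it preserves divisibility by ['X^n], so no
    precision is lost. *)
Definition theta (p : {poly rat}) : {poly rat} := 'X * p^`().

Lemma coef_theta p i : (theta p)`_i = p`_i *+ i.
Proof.
by rewrite /theta coefXM; case: i => [|i]; rewrite ?mulr0n // coef_deriv.
Qed.

Lemma thetaM p q : theta (p * q) = theta p * q + p * theta q.
Proof. by rewrite /theta derivM; ring. Qed.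

Lemma theta_sub p q : theta (p - q) = theta p - theta q.
Proof. by rewrite /theta derivB mulrBr. Qed.

Lemma theta_Xn n : theta 'X^n = 'X^n *+ n.
Proof.
rewrite /theta derivXn; case: n => [|n]; first by rewrite !mulr0n mulr0.
by rewrite mulrnAr -exprS.
Qed.

Lemma dvd_theta n p : 'X^n %| p -> 'X^n %| theta p.
Proof.
move=> /dvdpP [q ->]; rewrite thetaM theta_Xn dvdp_add ?dvdp_mull //.
by rewrite -mulr_natr dvdp_mulr.
Qed.

Lemma dvd_Xn_coef n (p : {poly rat}) :
  reflect (forall i, (i < n)%N -> p`_i = 0) ('X^n %| p).
Proof.
apply: (iffP idP) => [/dvdpP [q ->] i i_lt_n | p0].
  by rewrite coefMXn i_lt_n.
apply/dvdpP; exists (drop_poly n p).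
rewrite -[LHS](poly_take_drop n) -[RHS]add0r; congr (_ + _).
by apply/polyP => i; rewrite coef_take_poly coef0; case: ifP => // /p0.
Qed.

(** The congruence D = [theta p] / p modulo ['X^n], stated without inverting p. *)
Definition is_dlog n (p D : {poly rat}) : bool := 'X^n %| theta p - p * D.

Lemma is_dlogM n p q C D :
  is_dlog n p C -> is_dlog n q D -> is_dlog n (p * q) (C + D).
Proof.
move=> pC qD; rewrite /is_dlog thetaM.
have -> : theta p * q + p * theta q - p * q * (C + D)
  = (theta p - p * C) * q + p * (theta q - q * D) by ring.
by apply: dvdp_add; [exact: dvdp_mulr | exact: dvdp_mull].
Qed.

Lemma is_dlog_prod n m (p D : nat -> {poly rat}) :
  (forall k, is_dlog n (p k) (D k)) ->
  is_dlog n (\prod_(k < m) p k) (\sum_(k < m) D k).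
Proof.
move=> pD; elim: m => [|m IHm]; last by rewrite !big_ord_recr is_dlogM.
by rewrite !big_ord0 /is_dlog /theta derivC mulr0 mulr0 subr0 dvdp0.
Qed.

(** A nonzero constant term makes p coprime to ['X^n], so p can be cancelled from p (C - D). *)
Lemma is_dlog_uniq n (p q C D : {poly rat}) : p`_0 != 0 -> 'X^n %| p - q ->
  is_dlog n p C -> is_dlog n q D -> 'X^n %| C - D.
Proof.
move=> p0 pq pC qD.
have : 'X^n %| p * (C - D).
  have -> : p * (C - D) = theta (p - q) - (theta p - p * C)
    + (theta q - q * D) - (p - q) * D by rewrite theta_sub; ring.
  apply: dvdp_sub; last exact: dvdp_mulr.
  by apply: dvdp_add => //; apply: dvdp_sub => //; apply: dvd_theta.
rewrite Gauss_dvdpr // coprimep_expl // coprimep_sym -['X]subr0 -polyC0.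
by rewrite coprimep_XsubC /root horner_coef0.
Qed.

(** Truncation of X^k / (1 - X^k), exact through degree n when k > 0. *)
Definition geom (n k : nat) : {poly rat} := \sum_(j < n) 'X^(k * j.+1).

Lemma coef_geom n k i : (0 < k)%N -> (0 < i <= n)%N ->
  (geom n k)`_i = (k %| i)%:R.
Proof.
move=> k_gt0 /andP[i_gt0 i_le_n].
rewrite coef_sum; under eq_bigr do rewrite coefXn.
case: dvdnP => [[j def_i] | ndvd]; last first.
  rewrite big1 // => j _; case: eqP => // def_i; case: ndvd.
  by exists j.+1; rewrite mulnC.
have j_gt0 : (0 < j)%N by case: j def_i i_gt0 => // ->.
have j_lt : (j.-1 < n)%N.
  by rewrite prednK // (leq_trans _ i_le_n) // def_i leq_pmulr.
rewrite (bigD1 (Ordinal j_lt)) //= prednK // def_i mulnC eqxx big1 ?addr0 //.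
move=> l; rewrite -val_eqE /= eqn_pmul2l // -(prednK j_gt0) eqSS eq_sym.
by move/negPf ->.
Qed.

(** The geometric sum telescopes and leaves the error k X^(k(n+1)), whose exponent is at least
    n+1. *)
Lemma is_dlog_1subXn n k : (0 < k)%N ->
  is_dlog n.+1 (1 - 'X^k) (- geom n k *+ k).
Proof.
move=> k_gt0.
have tele : (1 - 'X^k) * geom n k = 'X^k - 'X^(k * n.+1).
  rewrite /geom; elim: n => [|n IHn]; first by rewrite big_ord0 muln1; ring.
  by rewrite big_ord_recr /= mulrDr IHn [in RHS]mulnS exprD; ring.
rewrite /is_dlog mulrnAr mulrN tele theta_sub theta_Xn.
have -> : theta 1 = 0 by rewrite /theta derivC mulr0.
rewrite sub0r mulNrn opprK mulrnBl addKr.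
rewrite dvdpNr -mulr_natr dvdp_mulr // dvdp_exp2l //.
by rewrite leq_pmull.
Qed.

(** * The generating function of the triangular numbers *)

Definition psi n : {poly rat} := \poly_(i < n.+1) (triangular i)%:R.

Lemma coef_psiX n r : (psi n ^+ r)`_n = (t r n)%:R.
Proof.
rewrite /psi poly_def -[r in LHS]card_ord -prodr_const.
rewrite bigA_distr_bigA /= coef_sum /t -sum1_card natr_sum [RHS]big_mkcond /=.
(* The expanded power is indexed by functions, while [t] counts tuples; [tup] translates. *)
pose tup (f : {ffun 'I_r -> 'I_n.+1}) := [tuple f i | i < r].
have tup_bij : bijective tup.
  exists (fun T : r.-tuple _ => [ffun i => tnth T i]) => [f | T].
    by apply/ffunP => i; rewrite ffunE tnth_mktuple.
  by apply: eq_from_tnth => i; rewrite tnth_mktuple ffunE.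
rewrite [RHS](reindex tup) /=; last exact: onW_bij.
apply: eq_bigr => f _; rewrite inE.
have -> : (\sum_i tnth (tup f) i = \sum_i f i)%N.
  by apply: eq_bigr => i _; rewrite tnth_mktuple.
under eq_forallb do rewrite tnth_mktuple.
have -> : \prod_i ((triangular (f i))%:R *: 'X^(f i))
  = (\prod_i (triangular (f i))%:R) *: 'X^(\sum_i f i)%N :> {poly rat}.
  by rewrite scaler_prod -expr_sum.
rewrite coefZ coefXn eq_sym.
case: (boolP [forall i, triangular (f i)])
  => [/forallP tri | /forallPn [i ntri]].
  by rewrite big1 => [|i _]; rewrite ?tri // mul1r; case: (_ == n).
by rewrite (bigD1 i) //= (negPf ntri) !mul0r.
Qed.

Lemma triangular_number_inj : injective triangular_number.
Proof.
have mono : {homo triangular_number : i j / (i < j)%N}.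
  apply: homo_ltn => [|i]; first exact: ltn_trans.
  have -> : triangular_number i.+1 = (triangular_number i + i.+1)%N.
    rewrite /triangular_number.
    have -> : (i.+1 * i.+2 = i * i.+1 + i.+1.*2)%N by lia.
    by rewrite halfD doubleK odd_double andbF.
  by rewrite -addSnnS leq_addr.
by move=> i j eq_ij; case: (ltngtP i j) => // /mono; rewrite eq_ij ltnn.
Qed.

Lemma coef_sum_triangular n i : (0 < n)%N -> (i <= n)%N ->
  (\sum_(m < n.*2) 'X^(triangular_number m))`_i = (triangular i)%:R :> rat.
Proof.
move=> n_gt0 i_le_n; rewrite coef_sum; under eq_bigr do rewrite coefXn.
case: triangularP => [[m def_i] | ntri]; last first.
  by rewrite big1 // => m _; case: eqP => // def_i; case: ntri; exists m.
have m_lt : (m < n.*2)%N.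
  have := leq_triangular_number m; rewrite -def_i; lia.
rewrite (bigD1 (Ordinal m_lt)) //= def_i eqxx big1 ?addr0 // => l.
rewrite -val_eqE /= (inj_eq triangular_number_inj) eq_sym.
by move/negPf ->.
Qed.

Lemma gauss_psi n : (0 < n)%N ->
  'X^(n.+1) %| (\prod_(k < n) (1 - 'X^(k.*2.+1))) * psi n
             - \prod_(k < n) (1 - 'X^(k.+1.*2)).
Proof.
move=> n_gt0.
set O := \prod_(k < n) _; set E := \prod_(k < n) _.
set S : {poly rat} := \sum_(m < n.*2) 'X^(triangular_number m).
have -> : O * psi n - E = O * (psi n - S) + (O * S - E) by ring.
apply: dvdp_add.
  apply/dvdp_mull/dvd_Xn_coef => i i_lt.
  by rewrite coefB coef_sum_triangular // coef_poly i_lt subrr.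
rewrite /O /S shanks_identity /E => {O S E}.
case: n n_gt0 => // n _.
(* The term s = 0 cancels the even product. With n now shifted by one, the others carry exponents
   s(2n+3), beyond the precision n+2. *)
rewrite [X in X - _]big_ord_recl mul0n expr0 mulr1.
rewrite [X in X + _ - _]/shanks_weight big_mkord big_ord0 mulr1.
rewrite addrAC subrr add0r.
apply: (big_ind (fun p : {poly rat} => 'X^(n.+2) %| p)) => [|p q|i _].
- exact: dvdp0.
- exact: dvdp_add.
- apply/dvdp_mull/dvdp_exp2l; rewrite lift0 mulSn -muln2; lia.
Qed.

(** * The truncated logarithm of Psi *)

(** Stopping at the n-th power is exact through degree n, because [1 - psi n] has zero constant
    term. *)
Definition log_psi n : {poly rat} :=
  - \sum_(j < n) j.+1%:R^-1 *: (1 - psi n) ^+ j.+1.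

Lemma coef0_psi n : (psi n)`_0 = 1.
Proof.
rewrite coef_poly /=; case: triangularP => // ntri.
by case: ntri; exists 0.
Qed.

Lemma theta_log_psi n :
  theta (log_psi n) = (\sum_(j < n) (1 - psi n) ^+ j) * theta (psi n).
Proof.
rewrite /theta /log_psi derivN linear_sum mulrN mulr_sumr -sumrN mulr_suml.
apply: eq_bigr => j _; rewrite /= derivZ deriv_exp derivB derivC sub0r /=.
rewrite -scaler_nat scalerA mulVf ?pnatr_eq0 // scale1r; ring.
Qed.

Lemma is_dlog_psi n : is_dlog n.+1 (psi n) (theta (log_psi n)).
Proof.
have geometric : psi n * \sum_(j < n) (1 - psi n) ^+ j = 1 - (1 - psi n) ^+ n.
  have := subrX1 (1 - psi n) n.
  have -> : 1 - psi n - 1 = - psi n by ring.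
  by rewrite mulNr => /(congr1 -%R); rewrite opprK opprB.
rewrite /is_dlog theta_log_psi mulrA geometric.
have -> : theta (psi n) - (1 - (1 - psi n) ^+ n) * theta (psi n)
  = (1 - psi n) ^+ n * theta (psi n) by ring.
(* The power of [1 - psi n] yields only X^n; the last factor X comes from [theta]. *)
rewrite exprSr dvdp_mul ?dvdp_exp2r ?dvdp_mulIl //.
rewrite -['X]expr1; apply/dvd_Xn_coef => -[|//] _.
by rewrite coefB coef1 coef0_psi subrr.
Qed.

Lemma coef_log_psi n : (0 < n)%N ->
  (log_psi n)`_n
  = - \sum_(1 <= r < n.+1) (-1) ^+ r / r%:R * 'C(n, r)%:R * (t r n)%:R.
Proof.
move=> n_gt0; rewrite /log_psi coefN coef_sum; congr (- _).
pose F j r : rat := j.+1%:R^-1 * ((-1) ^+ r * (t r n)%:R * 'C(j.+1, r)%:R).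
have expand (j : 'I_n) :
  (j.+1%:R^-1 *: (1 - psi n) ^+ j.+1)`_n = \sum_(r < n.+1) F j r.
  rewrite coefZ exprBn coef_sum mulr_sumr.
  (* Since ['C(j.+1, r)] vanishes for r > j+1, r may run up to n for every j, which allows the
     exchange of sums. *)
  rewrite (big_ord_widen n.+1 (fun r => j.+1%:R^-1 *
    (((-1) ^+ r * 1 ^+ (j.+1 - r) * psi n ^+ r) *+ 'C(j.+1, r))`_n));
    last by rewrite ltnS.
  rewrite big_mkcond; apply: eq_bigr => r _; rewrite /F.
  case: ltnP => [_ | lt_r]; last by rewrite bin_small // !mulr0.
  rewrite coefMn expr1n mulr1 -[_ *+ 'C(_, _)]mulr_natr.
  rewrite -polyC1 -polyCN -polyC_exp coefCM.
  by rewrite coef_psiX.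
under eq_bigr do rewrite expand.
(* The terms with r = 0 vanish: the constant polynomial 1 has no coefficient in degree n > 0. *)
rewrite exchange_big big_ord_recl big1 => [|j _]; last first.
  by rewrite /F -coef_psiX expr0 coef1 gtn_eqF // !(mulr0, mul0r).
rewrite /= add0r big_add1 big_mkord; apply: eq_bigr => r _.
rewrite /F /bump /= add1n.
have -> : (-1) ^+ r.+1 / r.+1%:R * 'C(n, r.+1)%:R * (t r.+1 n)%:R
  = (-1) ^+ r.+1 * (t r.+1 n)%:R * ('C(n, r.+1)%:R / r.+1%:R) :> rat by ring.
rewrite -sum_bin_div // mulr_sumr; apply: eq_bigr => j _; ring.
Qed.

(** * Divisor sums *)

Lemma sum_dvdn_divisors (R : nmodType) n N (F : nat -> R) : (0 < n <= N)%N ->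
  \sum_(1 <= d < N.+1 | (d %| n)%N) F d = \sum_(d <- divisors n) F d.
Proof.
move=> /andP[n_gt0 n_le_N]; rewrite -big_filter; apply: perm_big.
apply: uniq_perm; rewrite ?filter_uniq ?iota_uniq ?divisors_uniq // => d.
rewrite mem_filter mem_index_iota -dvdn_divisors //.
case: (boolP (d %| n)%N) => // d_dvd.
by rewrite (dvdn_gt0 n_gt0 d_dvd) ltnS (leq_trans (dvdn_leq n_gt0 d_dvd)).
Qed.

Lemma sum_odd_even (V : nmodType) (F : nat -> V) m :
  \sum_(k < m) (F k.*2.+1 + F k.+1.*2) = \sum_(i < m.*2) F i.+1.
Proof.
elim: m => [|m IHm]; first by rewrite !big_ord0.
by rewrite doubleS !big_ord_recr IHm /= -addrA.
Qed.

(** By Gauss's identity and uniqueness, [theta (log_psi n)] is [even_geom - odd_geom] modulo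
    ['X^n.+1]; a divisor d of n contributes d if odd and -d if even. *)
Lemma coef_theta_log_psi n : (0 < n)%N ->
  (theta (log_psi n))`_n = - \sum_(d <- divisors n) (-1) ^+ d * d%:R.
Proof.
move=> n_gt0.
pose odd_geom : {poly rat} := \sum_(k < n) - geom n k.*2.+1 *+ k.*2.+1.
pose even_geom : {poly rat} := \sum_(k < n) - geom n k.+1.*2 *+ k.+1.*2.
have dlog_odd : is_dlog n.+1 (\prod_(k < n) (1 - 'X^(k.*2.+1))) odd_geom.
  apply: (@is_dlog_prod _ _ (fun k => 1 - 'X^(k.*2.+1))
    (fun k => - geom n k.*2.+1 *+ k.*2.+1)) => k; exact: is_dlog_1subXn.
have dlog_even : is_dlog n.+1 (\prod_(k < n) (1 - 'X^(k.+1.*2))) even_geom.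
  apply: (@is_dlog_prod _ _ (fun k => 1 - 'X^(k.+1.*2))
    (fun k => - geom n k.+1.*2 *+ k.+1.*2)) => k; exact: is_dlog_1subXn.
have nz0 : ((\prod_(k < n) (1 - 'X^(k.*2.+1))) * psi n)`_0 != 0.
  rewrite coef0M coef0_psi mulr1 coef0_prod big1 ?oner_neq0 // => k _.
  by rewrite coefB coef1 coefXn subr0.
have := is_dlog_uniq nz0 (gauss_psi n_gt0)
  (is_dlogM dlog_odd (is_dlog_psi n)) dlog_even.
move/dvd_Xn_coef/(_ n (ltnSn n)); rewrite coefB coefD addrAC => /eqP.
rewrite addr_eq0 => /eqP eqD.
apply: oppr_inj; rewrite -eqD opprK => {eqD nz0 dlog_odd dlog_even}.
(* The two products together involve all exponents up to 2n, so the divisor sum is extended to that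
   range. *)
rewrite -(@sum_dvdn_divisors _ n n.*2); last by lia.
rewrite big_mkcond big_add1 big_mkord /= /odd_geom /even_geom !coef_sum -sumrB.
rewrite -(sum_odd_even (fun d =>
  if (d %| n)%N then (-1) ^+ d * d%:R else 0)).
have coefk k : (0 < k)%N -> (- geom n k *+ k)`_n = - ((k %| n)%:R * k%:R).
  move=> k_gt0; rewrite coefMn coefN coef_geom ?n_gt0 ?leqnn //.
  by rewrite mulNrn mulr_natr.
apply: eq_bigr => k _; rewrite coefk // coefk //.
rewrite -[_ ^+ k.*2.+1]signr_odd -[_ ^+ k.+1.*2]signr_odd /= !odd_double.
rewrite expr0 expr1.
by do 2!case: (_ %| _)%N; rewrite !(mulr1n, mulr0n); ring.
Qed.

(** The involution d -> n/d permutes the divisors. *)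
Lemma sum_divisors_div (n : nat) : (0 < n)%N ->
  \sum_(d <- divisors n) n%:R / d%:R = \sum_(d <- divisors n) d%:R :> rat.
Proof.
move=> n_gt0; have dvdP d : d \in divisors n -> (0 < d)%N && (d %| n)%N.
  by rewrite -dvdn_divisors // => d_dvd; rewrite (dvdn_gt0 n_gt0 d_dvd).
rewrite [RHS](perm_big [seq (n %/ d)%N | d <- divisors n]) /=.
  rewrite big_map; apply: eq_big_seq => d /dvdP /andP[d_gt0 d_dvd].
  by rewrite -[in LHS](divnK d_dvd) natrM mulfK // pnatr_eq0 -lt0n.
have invK : {in divisors n, cancel (fun d => n %/ d) (fun d => n %/ d)}%N.
  by move=> d /dvdP /andP[d_gt0 d_dvd]; rewrite divnA // mulKn.
rewrite perm_sym; apply: uniq_perm; rewrite ?divisors_uniq //.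
  by rewrite map_inj_in_uniq ?divisors_uniq //; apply: can_in_inj invK.
move=> d; apply/mapP/idP => [[e /dvdP /andP[e_gt0 e_dvd] ->] | d_div].
  by rewrite -dvdn_divisors // dvdn_div.
exists (n %/ d)%N; last by rewrite invK.
by have /andP[_ d_dvd] := dvdP d d_div; rewrite -dvdn_divisors // dvdn_div.
Qed.

(** The factor 1 + (-1)^d selects the even divisors of 2m, which are the doubles of the divisors of
    m. *)
Lemma sum_even_divisors (m : nat) (F : nat -> rat) : (0 < m)%N ->
  \sum_(d <- divisors m.*2) (1 + (-1) ^+ d) * F d
  = \sum_(e <- divisors m) 2 * F e.*2.
Proof.
move=> m_gt0; have m2_gt0 : (0 < m.*2)%N by rewrite double_gt0.
rewrite (bigID odd) /= big1 ?add0r => [|d odd_d]; last first.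
  by rewrite -signr_odd odd_d expr1 subrr mul0r.
rewrite -big_filter (perm_big [seq e.*2 | e <- divisors m]) /=.
  by rewrite big_map; apply: eq_bigr => e _; rewrite -signr_odd odd_double.
apply: uniq_perm; rewrite ?filter_uniq ?divisors_uniq //.
  by rewrite map_inj_uniq ?divisors_uniq //; apply: double_inj.
move=> d; rewrite mem_filter -dvdn_divisors //.
apply/andP/mapP => [[even_d d_dvd] | [e e_div ->]].
  exists d./2; last by rewrite even_halfK.
  by rewrite -dvdn_divisors // -(@dvdn_pmul2r 2) // !muln2 even_halfK.
by rewrite odd_double -!muln2 dvdn_pmul2r // dvdn_divisors.
Qed.

(** Split 1 + 2(-1)^d as 2(1 + (-1)^d) - 1 and (-1)^d as (1 + (-1)^d) - 1. The parts from -1 agree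
    under d -> n/d; the even parts are both four times the divisor sum of n/2, or zero for odd n. *)
Lemma sum_divisors_alternating (n : nat) : (0 < n)%N ->
  n%:R * \sum_(d <- divisors n) (1 + 2 * (-1) ^+ d) / d%:R
  = \sum_(d <- divisors n) (-1) ^+ d * d%:R :> rat.
Proof.
move=> n_gt0.
have even_part : \sum_(d <- divisors n) (1 + (-1) ^+ d) * (2 * (n%:R / d%:R))
  = \sum_(d <- divisors n) (1 + (-1) ^+ d) * d%:R :> rat.
  case: (boolP (odd n)) => [odd_n | even_n].
    have van (F : nat -> rat) :
      \sum_(d <- divisors n) (1 + (-1) ^+ d) * F d = 0.
      apply: big1_seq => d /=; rewrite -dvdn_divisors // => d_dvd.
      by rewrite -signr_odd (dvdn_odd d_dvd) // expr1 subrr mul0r.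
    by rewrite !van.
  have def_n := even_halfK even_n.
  have m_gt0 : (0 < n./2)%N by rewrite -double_gt0 def_n.
  rewrite -def_n !sum_even_divisors //.
  transitivity (\sum_(e <- divisors n./2) 4 * ((n./2)%:R / e%:R) : rat).
    apply: eq_big_seq => e; rewrite -dvdn_divisors //.
    move=> /(dvdn_gt0 m_gt0) e_gt0.
    rewrite -!muln2 !natrM; field; by rewrite pnatr_eq0 -lt0n.
  rewrite -mulr_sumr sum_divisors_div // mulr_sumr.
  by apply: eq_bigr => e _; rewrite -muln2 natrM; ring.
transitivity (\sum_(d <- divisors n) (1 + (-1) ^+ d) * (2 * (n%:R / d%:R))
  - \sum_(d <- divisors n) n%:R / d%:R : rat).
  by rewrite mulr_sumr -sumrB; apply: eq_bigr => d _; ring.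
rewrite even_part sum_divisors_div // -sumrB.
by apply: eq_bigr => d _; ring.
Qed.

Theorem theorem1 (n : nat) (n_gt0 : (0 < n)%N) :
  \sum_(d <- divisors n) (1 + 2 * (-1) ^+ d) / d%:R
  = \sum_(1 <= r < n.+1) (-1) ^+ r / r%:R * 'C(n, r)%:R * (t r n)%:R :> rat.
Proof.
have n_neq0 : n%:R != 0 :> rat by rewrite pnatr_eq0 -lt0n.
apply: (mulfI n_neq0); rewrite sum_divisors_alternating //.
(* After multiplication by n, both sides are minus the n-th coefficient of [theta (log_psi n)]. *)
apply: oppr_inj; rewrite -coef_theta_log_psi // coef_theta coef_log_psi //.
by rewrite mulNrn mulr_natl.
Qed.
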